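(* Let $n\ge1$, let $\mathbf s=[s_0,\dots,s_{2n-1}]^\top\in\mathbb C^{2n}$, assume that the zeros $z_0^n,\dots,z_{n-1}^n$ of $Q_n$ are simple, and let $V\in\mathbb C^{2n\times n}$ be the matrix with entries $V[k,j]=(z_j^n)^{k-1}$ ($k=0,\dots,2n-1$, $j=0,\dots,n-1$). Then the overdetermined system of linear equations $$\mathbf s=V\mathbf x$$ is consistent and has precisely one solution, namely $\mathbf x=\boldsymbol\rho=[\rho_0^n,\dots,\rho_{n-1}^n]^\top$, where $\rho_j^n$ is the residue of $Z_{[n-1/n]}(w)=s_0wP_n(w)/Q_n(w)$ at $z_j^n$.
   Context: Let $n\ge1$ and $s_0,\dots,s_{2n-1}\in\mathbb C$. Define $f_l^k$ by $f_{-2}^k=f_{-1}^k=\delta_{0,k}$, $f_0^k=s_k$, and $f_{l+1}^k=\frac{(-1)^l}{f_{l-2}^0}\left[f_l^0f_{l-1}^{k+1}-f_{l-1}^0f_l^{k+1}\right]$ for $l\ge 0$ ($f_l^k$ depends only on $s_0,\dots,s_{l+k}$). Standing assumption: $f_l^0\ne 0$ for $0\le l\le 2n-1$ (in particular the zeros of $Q_n$ below are nonzero, since $Q_n(0)=r_1r_3\cdots r_{2n-1}$). Put $r_l=(-1)^{l-1}\frac{f_l^0f_{l-3}^0}{f_{l-2}^0f_{l-1}^0}$ for $1\le l\le 2n-1$, and for $1\le l\le n-1$: $c_l=-(r_{2l}+r_{2l+1})$, $d_l=r_{2l-1}r_{2l}$. Monic polynomials $P_l,Q_l$ ($0\le l\le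 n$) are given by $P_0=0$, $P_1=1$, $Q_0=1$, $Q_1(w)=w+r_1$ and, for $1\le l\le n-1$, $$P_{l+1}(w)=(w-c_l)P_l(w)-d_lP_{l-1}(w),\qquad Q_{l+1}(w)=(w-c_l)Q_l(w)-d_lQ_{l-1}(w).$$ The rational function $Z_{[n-1/n]}(w)=s_0wP_n(w)/Q_n(w)$ is the $[n-1/n]$ Padé approximation of $\sum_k s_kz^k$ written in the variable $w=z^{-1}$. *)

(* Defs.v *)
From HB Require Import structures.
From mathcomp Require Import all_boot all_order all_algebra.
From mathcomp Require Import all_classical all_reals all_analysis.
From mathcomp Require Export complex.
Set Implicit Arguments.
Unset Strict Implicit.
Unset Printing Implicit Defensive.
Import Order.TTheory GRing.Theory Num.Theory.
Import numFieldNormedType.Exports.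
Local Open Scope classical_set_scope.
Local Open Scope ring_scope.

Section Residue.
Variable C : numFieldType.

(* c is the coefficient u_{-1} of a Laurent expansion
   f(w) = \sum_{k >= -m} u_k (w - a)^k, valid on a punctured neighbourhood of a
   (f is holomorphic or has a pole at a). *)
Definition is_residue (f : C -> C) (a c : C) : Prop :=
  exists (u : int -> C) (m : nat),
    [/\ u (-1) = c,
        forall k : int, k < - m%:Z -> u k = 0 &
        \forall w \near a^',
          [series u (k%:Z - m%:Z) * (w - a) ^ (k%:Z - m%:Z)]_k @ \oo --> f w].

Definition residue (f : C -> C) (a : C) : C := xget 0 [set c | is_residue f a c].

End Residue.

Section Pade.
Variable C : fieldType.

(* The entries f_l^k with s_0, ..., s_{l+k} in range do not depend on the
   extension by zero. *)
Definition extend0 (N : nat) (s : 'cV[C]_N) (k : nat) : C :=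
  if insub k is Some i then s i 0 else 0.

Variable s : nat -> C.

(* f_shift l k = f_{l-2}^k *)
Fixpoint f_shift (l k : nat) {struct l} : C :=
  match l with
  | 0%N | 1%N => (k == 0%N)%:R
  | 2%N => s k
  | S ((S ((S l0) as l1)) as l2) =>
      (-1) ^+ l0 / f_shift l0 0 *
      (f_shift l2 0 * f_shift l1 k.+1 - f_shift l1 0 * f_shift l2 k.+1)
  end.

(* f_l^k, meaningful for l >= -2 *)
Definition f_ (l : int) (k : nat) : C := f_shift (absz (l + 2)) k.

(* r_l for l >= 1; c_l and d_l likewise *)
Definition r_ (l : nat) : C :=
  (-1) ^+ (l - 1) * ((f_ l 0 * f_ (l%:Z - 3) 0) / (f_ (l%:Z - 2) 0 * f_ (l%:Z - 1) 0)).

Definition c_ (l : nat) : C := - (r_ (2 * l) + r_ (2 * l + 1)).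
Definition d_ (l : nat) : C := r_ (2 * l - 1) * r_ (2 * l).

Fixpoint three_term (p0 p1 : {poly C}) (l : nat) : {poly C} :=
  match l with
  | 0%N => p0
  | 1%N => p1
  | S ((S l0) as l1) =>
      ('X - (c_ l1)%:P) * three_term p0 p1 l1 - d_ l1 *: three_term p0 p1 l0
  end.

Definition P_ : nat -> {poly C} := three_term 0 1.
Definition Q_ : nat -> {poly C} := three_term 1 ('X + (r_ 1)%:P).

(* The [n-1/n] Pade approximant of \sum_k s_k z^k in the variable w = z^-1;
   the value at a zero of Q_n is irrelevant. *)
Definition Z_ (n : nat) (w : C) : C := s 0%N * w * (P_ n).[w] / (Q_ n).[w].

End Pade.

(* V[k, j] = (z_j)^(k-1); the first row is z_j^-1 *)
Definition shifted_vandermonde (C : fieldType) (m n : nat) (z : 'I_n -> C) :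
    'M[C]_(m, n) :=
  \matrix_(k < m, j < n) z j ^ (k%:Z - 1).

(* Main.v *)
Require Import Defs.
From HB Require Import structures.
From mathcomp Require Import all_boot all_order all_algebra.
From mathcomp Require Import all_classical all_reals all_analysis.
From mathcomp Require Import ring zify.
Set Implicit Arguments.
Unset Strict Implicit.
Unset Printing Implicit Defensive.
Import Order.TTheory GRing.Theory Num.Theory.
Import numFieldNormedType.Exports.
Local Open Scope ring_scope.
Local Open Scope complex_scope.

(** The numbers [f_l^k] generate the Stieltjes continued fraction of
    [sum_k s_k t^k], and [Q_l], [P_l] are the denominators and numerators of its
    even contraction.  In the variable [w = 1/t] this means
      [Q_l(w) * sum_k s_k w^(-k-1) - s_0 P_l(w) = O(w^(-l-1))],
    with a remainder whose coefficients are, up to sign and a common factor, the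
    numbers [f_(2l)^k].  Reading off the coefficients of [w^(-m-1)] gives the
    orthogonality of [Q_l] with respect to the functional [w^k |-> s_k]
    ([moment_Q], [moment_Q_eq0]).

    Because the [z_j] are distinct, weights [y_j] exist with
    [sum_j y_j z_j^k = s_k] for [k < n] (Vandermonde).  The orthogonality of
    [Q_n] to [1, ..., w^(n-1)] is a linear recurrence of order [n] satisfied by
    the [s_k], and also by each sequence [z_j^k]; so the [n] equations propagate
    to all [k < 2n] ([quadrature_extend], the exactness of Gauss quadrature).
    Since the [z_j] are nonzero, [x_j = y_j z_j] then solves the system.

    Conversely, any solution [x] gives weights [y_j = x_j / z_j] as above, and
    the three-term recurrence yields the partial fractions
    [s_0 P_n / Q_n = sum_j y_j / (w - z_j)] ([Pade_partial_fractions]).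
    Multiplying by [w], the residue of the approximant at [z_j] is
    [y_j z_j = x_j] ([residue_Z]).  Every solution is therefore the vector of
    residues, which proves uniqueness and identifies the solution at once.

    The residue is defined by choosing a coefficient of some Laurent expansion,
    so its value is pinned down by the uniqueness of such expansions
    ([is_residue_unique]), which rests on the identity theorem for power series
    ([power_series_eq0]); the required expansions come from geometric series. *)

(** * Orthogonality of the Pade denominators *)

Section PadeTable.
Variables (C : fieldType) (s : nat -> C).
Implicit Types (p q : {poly C}) (l m n k : nat).

Local Notation F := (f_shift s).
Local Notation P_ := (P_ s).
Local Notation Q_ := (Q_ s).
Local Notation r_ := (r_ s).

Lemma f_natE l k : f_ s l k = F l.+2 k.
Proof. by rewrite /f_ -PoszD absz_nat addn2. Qed.

(** A one-step unfolding, so that [f_shift] need not be simplified. *)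
Lemma f_shiftSSS l k : F l.+3 k =
  (-1) ^+ l / F l 0 * (F l.+2 0 * F l.+1 k.+1 - F l.+1 0 * F l.+2 k.+1).
Proof. by []. Qed.

Local Arguments f_shift : simpl never.

Lemma r_shiftE l : r_ l.+1 =
  (-1) ^+ l * (F l.+3 0 * F l 0 / (F l.+1 0 * F l.+2 0)).
Proof.
rewrite /r_ subn1 /= f_natE /f_.
have -> : absz (l.+1%:Z - 3 + 2) = l by lia.
have -> : absz (l.+1%:Z - 2 + 2) = l.+1 by lia.
by have -> : absz (l.+1%:Z - 1 + 2) = l.+2 by lia.
Qed.

Lemma c_SE l : c_ s l.+1 = - (r_ l.*2.+2 + r_ l.*2.+3).
Proof. by rewrite /c_ mul2n addn1. Qed.

Lemma d_SE l : d_ s l.+1 = r_ l.*2.+1 * r_ l.*2.+2.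
Proof. by rewrite /d_ mul2n subn1. Qed.

Lemma PSS l :
  P_ l.+2 = ('X - (c_ s l.+1)%:P) * P_ l.+1 - d_ s l.+1 *: P_ l.
Proof. by []. Qed.

Lemma QSS l :
  Q_ l.+2 = ('X - (c_ s l.+1)%:P) * Q_ l.+1 - d_ s l.+1 *: Q_ l.
Proof. by []. Qed.

Lemma nat_ind2 (A : nat -> Prop) :
  A 0 -> A 1 -> (forall l, A l -> A l.+1 -> A l.+2) -> forall l, A l.
Proof.
move=> A0 A1 AS l; suff [] : A l /\ A l.+1 by [].
by elim: l => // l [Al AlS]; split=> //; exact: AS.
Qed.

Lemma size_Q l : (size (Q_ l) <= l.+1)%N.
Proof.
elim/nat_ind2: l => [||l IH0 IH1].
- by rewrite size_poly1.
- by rewrite size_XaddC.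
rewrite QSS (leq_trans (size_polyD _ _)) // geq_max size_polyN.
rewrite (leq_trans (size_polyMleq _ _)) ?size_XsubC //=.
by rewrite (leq_trans (size_scale_leq _ _)) // (leq_trans IH0) // !ltnS ltnW.
Qed.

(** The value at [w^m * p(w)] of the linear functional [w^k |-> s_k]; it is also
    the coefficient of [w^(-m-1)] in [p(w) * sum_k s_k w^(-k-1)]. *)
Definition moment m p : C := \sum_(i < size p) p`_i * s (m + i).

Lemma momentE m p N : (size p <= N)%N ->
  moment m p = \sum_(i < N) p`_i * s (m + i).
Proof.
move=> pN; rewrite /moment (big_ord_widen N (fun i => p`_i * s (m + i))) //.
rewrite big_mkcond; apply: eq_bigr => i _; case: ltnP => // /leq_sizeP.
by move=> ->; rewrite ?mul0r.
Qed.

Lemma momentC m a : moment m a%:P = a * s m.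
Proof.
by rewrite (momentE _ (size_polyC_leq1 a)) big_ord1 coefC addn0.
Qed.

Lemma moment_recl m p q c d :
  moment m (('X - c%:P) * p - d *: q) =
    moment m.+1 p - c * moment m p - d * moment m q.
Proof.
have [N pN qN] : exists2 N, (size p <= N)%N & (size q <= N)%N.
  by exists (maxn (size p) (size q)); rewrite ?leq_maxl ?leq_maxr.
rewrite (@momentE _ _ N.+1); last first.
  rewrite (leq_trans (size_polyD _ _)) // geq_max size_polyN.
  rewrite (leq_trans (size_polyMleq _ _)) ?size_XsubC //=.
  by rewrite (leq_trans (size_scale_leq _ _)) // ltnW.
rewrite (momentE _ pN) (momentE _ (leqW pN)) (momentE _ (leqW qN)).
have -> : \sum_(i < N) p`_i * s (m.+1 + i) =
          \sum_(i < N.+1) ('X * p)`_i * s (m + i).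
  rewrite big_ord_recl coefXM /= mul0r add0r; apply: eq_bigr => i _.
  by rewrite coefXM /= /bump /= add1n addSnnS.
rewrite !mulr_sumr -!sumrB; apply: eq_bigr => i _.
by rewrite mulrBl coefB coefB coefZ coefCM; ring.
Qed.

(** These are the coefficients of the remainder
      [Q_l(w) * sum_k s_k w^(-k-1) - s_0 P_l(w)
        = (-1)^l w^(-l-1) / f_(2l-2)^0 * sum_k f_(2l)^k w^(-k)].
    The induction combines three consecutive steps of the recurrence for [f_l]
    into one relating [f_(2l+4)], [f_(2l+2)] and [f_(2l)], in which [c] and [d]
    appear as coefficients. *)
Lemma moment_Q n : (forall l, (l < n.*2)%N -> F l.+2 0 != 0) ->
  forall l m, (l <= n)%N ->
    moment m (Q_ l) =
      if (l <= m)%N then (-1) ^+ l * F l.*2.+2 (m - l) / F l.*2 0 else 0.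
Proof.
move=> F0; elim/nat_ind2 => [||l IH0 IH1] m ln.
- by rewrite momentC mul1r subn0 expr0 mul1r /= divr1.
- have -> : Q_ 1 = ('X - (- r_ 1)%:P) * 1 - 0 *: 0.
    by rewrite mulr1 scale0r subr0 polyCN opprK.
  have s0 : s 0%N != 0 by apply: (F0 0%N); rewrite double_gt0.
  rewrite moment_recl !momentC r_shiftE; case: m => [|m].
    by rewrite f_shiftSSS expr0 /f_shift /=; field; rewrite ?s0 ?oner_neq0.
  by rewrite ltnS /= subSS subn0 /f_shift /=; field; rewrite ?s0 ?oner_neq0.
have nz k : (k <= l.*2 + 5)%N -> F k 0 != 0.
  case: k => [|[|k kl]]; rewrite /= ?oner_neq0 //.
  by apply: F0; rewrite -addnn in kl *; lia.
rewrite QSS moment_recl c_SE d_SE !IH0 ?(ltnW ln) ?(ltnW (ltnW ln)) //.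
rewrite !IH1 ?(ltnW ln) //.
have sgn : (-1) ^+ l.*2 = 1 :> C by rewrite -mul2n exprM sqrrN !expr1n.
rewrite !r_shiftE !doubleS !exprS sgn.
move: nz sgn; set D := l.*2; clearbody D => nz sgnD.
have [n0 n1 n2 n3] : [/\ F D 0 != 0, F D.+1 0 != 0,
  F D.+2 0 != 0 & F D.+3 0 != 0] by split; apply: nz; lia.
have n4 : F D.+4 0 != 0 by apply: nz; lia.
have [ml|lm] := ltnP m l.
  by rewrite !ifN ?mulr0 ?subr0 // -?leqNgt -?ltnNge; lia.
have {lm} [k ->] : exists k, m = (l + k)%N by exists (m - l)%N; lia.
case: k => [|k].
  rewrite addn0 ltnSn ltnn subSS subnn (ltnNge l.+1) leqnSn /=.
  by field; rewrite n0 n1 n2 n3 n4.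
(* Solving the recurrence for its oldest term expresses the entries of rows
   [D.+2] and [D.+3] through rows [D.+4] and [D.+5]; what remains is the
   recurrence defining row [D.+4.+2]. *)
have R5 : F D.+3 k.+1 =
    (F D.+2 0 * F D.+4.+1 k + F D.+3 0 * F D.+4 k.+1) / F D.+4 0.
  by rewrite (f_shiftSSS D.+2) !exprS sgnD; field; rewrite n2 n4.
have R4 : F D.+2 k.+1 =
    (F D.+2 0 * F D.+3 k.+1 - F D.+1 0 * F D.+4 k) / F D.+3 0.
  by rewrite (f_shiftSSS D.+1 k) !exprS sgnD; field; rewrite n1 n3.
rewrite addnS !subSS (addnC l k) addnK !ltnS leq_addl -addSn addnK.
rewrite leqW ?leq_addl //.
rewrite R4 R5.
case: k {R4 R5} => [|k].
  by rewrite add0n ltnn; field; rewrite n0 n1 n2 n3 n4.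
rewrite addSn ltnS leq_addl subSS addnK (f_shiftSSS D.+3 k) !exprS sgnD.
by field; rewrite n0 n1 n2 n3 n4.
Qed.

Lemma moment_Q_eq0 n l : (forall l, (l < n.*2)%N -> F l.+2 0 != 0) ->
  (l <= n)%N -> forall m, (m < l)%N -> moment m (Q_ l) = 0.
Proof. by move=> F0 ln m ml; rewrite (moment_Q F0) // leqNgt ml. Qed.

(** At [w = 0] the three-term recurrence collapses to a two-term one, whence
    [Q_n(0) = r_1 r_3 ... r_(2n-1)]. *)
Lemma horner0_Q l : (Q_ l.+1).[0] = r_ l.*2.+1 * (Q_ l).[0].
Proof.
elim: l => [|l IH]; first by rewrite /Q_ /= !hornerE.
rewrite QSS hornerD hornerN hornerM hornerXsubC hornerZ IH c_SE d_SE doubleS.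
by ring.
Qed.

Lemma horner0_Q_neq0 n : (forall l, (l < n.*2)%N -> F l.+2 0 != 0) ->
  (Q_ n).[0] != 0.
Proof.
move=> F0; suff H l : (l <= n)%N -> (Q_ l).[0] != 0 by exact: H.
elim: l => [|l IH] ln; first by rewrite hornerC oner_neq0.
have nz k : (k <= l.*2 + 3)%N -> F k 0 != 0.
  case: k => [|[|k kl]]; rewrite /= ?oner_neq0 //.
  by apply: F0; rewrite -addnn in kl *; lia.
have [n0 n1 n2 n3] : [/\ F l.*2 0 != 0, F l.*2.+1 0 != 0,
  F l.*2.+2 0 != 0 & F l.*2.+3 0 != 0] by split; apply: nz; lia.
rewrite horner0_Q r_shiftE; apply: mulf_neq0 (IH (ltnW ln)).
apply: mulf_neq0; first by rewrite signr_eq0.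
by apply: mulf_neq0; [|apply: invr_neq0]; apply: mulf_neq0.
Qed.

(** The divided difference [E_l(w)] on the right satisfies the three-term
    recurrence up to the extra term [sum_j y_j Q_(l+1)(z_j)], which is the moment
    of [Q_(l+1)] and vanishes by orthogonality.  At [l = n], with the [z_j]
    zeros of [Q_n], dividing by [Q_n(w)] gives partial fractions for
    [s_0 P_n / Q_n]. *)
Lemma Pade_partial_fractions n m (y z : 'I_m -> C) :
    (forall l, (l < n.*2)%N -> F l.+2 0 != 0) ->
    (forall k, (k < n)%N -> \sum_(j < m) y j * z j ^+ k = s k) ->
  forall l w, (l <= n)%N -> (forall j, w != z j) ->
    s 0%N * (P_ l).[w] =
      \sum_(j < m) y j * (((Q_ l).[w] - (Q_ l).[z j]) / (w - z j)).
Proof.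
move=> F0 ys l w ln wz.
have wz0 j : w - z j != 0 by rewrite subr_eq0.
elim/nat_ind2: l ln => [||l IH0 IH1] ln.
- by rewrite horner0 mulr0 big1 // => j _; rewrite !hornerC subrr mul0r mulr0.
- rewrite hornerC mulr1 -ys //; apply: eq_bigr => j _.
  by rewrite !(hornerD, hornerX, hornerC); field.
have yQ : \sum_(j < m) y j * (Q_ l.+1).[z j] = 0.
  rewrite -[RHS](moment_Q_eq0 F0 (ltnW ln) (ltn0Sn l)).
  rewrite (momentE _ (size_Q l.+1)).
  under eq_bigr => j _ do
    rewrite (horner_coef_wide _ (size_Q l.+1)) mulr_sumr.
  rewrite exchange_big /=; apply: eq_bigr => i _.
  rewrite -ys ?(leq_trans (ltn_ord i)) // mulr_sumr.
  by apply: eq_bigr => j _; ring.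
have -> : s 0%N * (P_ l.+2).[w] = (w - c_ s l.+1) * (s 0%N * (P_ l.+1).[w])
    - d_ s l.+1 * (s 0%N * (P_ l).[w]) + \sum_(j < m) y j * (Q_ l.+1).[z j].
  rewrite yQ PSS hornerD hornerN hornerM hornerXsubC hornerZ.
  by ring.
rewrite IH1 ?IH0 ?(ltnW ln) ?(ltnW (ltnW ln)) // !mulr_sumr -sumrB -big_split.
apply: eq_bigr => j _ /=.
rewrite QSS !(hornerXsubC, hornerD, hornerN, hornerM, hornerZ).
by field.
Qed.

End PadeTable.

(** * Quadrature exact on twice as many moments *)

Section Quadrature.
Variables (C : fieldType) (s : nat -> C).

Lemma Vandermonde_moments n (z : 'I_n -> C) : injective z ->
  exists y : 'I_n -> C,
    forall k, (k < n)%N -> \sum_(j < n) y j * z j ^+ k = s k.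
Proof.
move=> z_inj; pose W := Vandermonde n (\row_j z j).
have Wu : W \in unitmx.
  rewrite unitmxE det_Vandermonde unitfE.
  apply/prodf_neq0 => i _; apply/prodf_neq0 => j ij; rewrite !mxE subr_eq0.
  by apply: contraTneq ij => /z_inj ->; rewrite ltnn.
have [y Wy] : exists y, W *m y = \col_(k < n) s k.
  by exists (invmx W *m \col_(k < n) s k); rewrite mulKVmx.
exists (fun j => y j 0) => k kn.
have /matrixP/(_ (Ordinal kn) 0) := Wy; rewrite !mxE => <-.
by apply: eq_bigr => j _; rewrite !mxE mulrC.
Qed.

(** Both [s_k] and [sum_j y_j z_j^k] satisfy the linear recurrence of order [n]
    with characteristic polynomial [Q_n]: the former by orthogonality of [Q_n],
    the latter because the [z_j] are its zeros. *)
Lemma quadrature_extend n (z y : 'I_n -> C) :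
    (forall l, (l < n.*2)%N -> f_shift s l.+2 0 != 0) ->
    Q_ s n = \prod_(j < n) ('X - (z j)%:P) ->
    (forall k, (k < n)%N -> \sum_(j < n) y j * z j ^+ k = s k) ->
  forall k, (k < n.*2)%N -> \sum_(j < n) y j * z j ^+ k = s k.
Proof.
move=> F0 Qprod ys; elim/ltn_ind => k IH k2n.
have [/ys //|nk] := ltnP k n.
have sizeQ : size (Q_ s n) = n.+1.
  by rewrite Qprod size_prod_XsubC [index_enum _]unlock -enumT size_enum_ord.
have leadQ : (Q_ s n)`_n = 1.
  have /monicP := monic_prod_XsubC (index_enum 'I_n) xpredT z.
  by rewrite -Qprod lead_coefE sizeQ.
have Qz j : (Q_ s n).[z j] = 0.
  by rewrite Qprod horner_prod (bigD1 j) //= hornerXsubC subrr mul0r.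
set m := (k - n)%N; have km : k = (m + n)%N by rewrite subnK.
have mn : (m < n)%N by rewrite -addnn in k2n; lia.
have /eqP := moment_Q_eq0 F0 (leqnn n) mn.
rewrite /moment sizeQ big_ord_recr /= leadQ mul1r -km addrC addr_eq0 => /eqP ->.
apply/eqP; rewrite -addr_eq0; apply/eqP.
transitivity (\sum_(j < n) y j * z j ^+ m * (Q_ s n).[z j]); last first.
  by apply: big1 => j _; rewrite Qz mulr0.
have -> : \sum_(i < n) (Q_ s n)`_i * s (m + i)%N =
    \sum_(j < n) \sum_(i < n) y j * z j ^+ m * ((Q_ s n)`_i * z j ^+ i).
  rewrite exchange_big /=; apply: eq_bigr => i _.
  have im : (m + i < k)%N by rewrite km ltn_add2l.
  rewrite -(IH _ im (ltn_trans im k2n)) mulr_sumr; apply: eq_bigr => j _.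
  by rewrite exprD; ring.
rewrite -big_split; apply: eq_bigr => j _ /=.
rewrite horner_coef sizeQ big_ord_recr /= leadQ mul1r mulrDr mulr_sumr addrC.
by congr (_ + _); rewrite -mulrA -exprD -km.
Qed.

End Quadrature.

Lemma simple_roots_inj (C : fieldType) n (z : 'I_n -> C) :
  (forall j, mup (z j) (\prod_(i < n) ('X - (z i)%:P)) = 1%N) -> injective z.
Proof.
move=> simple i j zij; apply/eqP; apply: contraT => ij.
suff : (2 <= mup (z j) (\prod_(i < n) ('X - (z i)%:P)))%N by rewrite simple.
rewrite mup_geq ?monic_neq0 ?monic_prod_XsubC //.
by rewrite (bigD1 j) //= (bigD1 i) //= zij mulrA dvdp_mulr.
Qed.

(** * Uniqueness of Laurent expansions *)

Section LaurentExpansions.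
Local Open Scope classical_set_scope.
Local Open Scope ring_scope.
Variable C : numFieldType.
Implicit Types (c : nat -> C) (a h : C).

Lemma sum_expr_le2 (t : C) n : 0 <= t <= 2^-1 -> \sum_(k < n) t ^+ k <= 2.
Proof.
case/andP=> t0 t2; elim: n => [|n IH]; first by rewrite big_ord0.
rewrite big_ord_recl expr0 (eq_bigr (fun i : 'I_n => t * t ^+ i)); last first.
  by move=> i _; rewrite -exprS.
rewrite -mulr_sumr -[leRHS]/(1 + 1) lerD2l.
apply: le_trans (ler_wpM2l t0 IH) _.
by rewrite -ler_pdivlMr // mul1r.
Qed.

(** The terms at one point [h0 > 0] of the disc are bounded by some [B], so at
    [h0 * t] with [0 < t <= 1/2] the partial sums differ from [c 0] by at most
    [2 * B * t]; taking [t] small and letting the partial sums tend to [0] forces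
    [c 0 = 0]. *)
Lemma power_series_eq0_coef0 c :
  (\forall h \near 0^', [series c k * h ^+ k]_k @ \oo --> (0 : C)) -> c 0%N = 0.
Proof.
move=> /nbhs_ballP[e /= e0 He].
apply/eqP; apply: contraT => c0.
have cvg_at h : h != 0 -> `|h| < e -> [series c k * h ^+ k]_k @ \oo --> (0 : C).
  by move=> h0 he; apply: He => //; rewrite /ball /= sub0r normrN.
pose h0 := e / 2; have h0gt : 0 < h0 by rewrite divr_gt0.
have h0e : h0 < e by rewrite gtr_pMr // invf_lt1 // ltr1n.
have [B B0 HB] : exists2 B : C, 0 < B & forall k, `|c k * h0 ^+ k| <= B.
  have : cvgn [series c k * h0 ^+ k]_k.
    apply: cvgP; apply: cvg_at; first by rewrite gt_eqF.
    by rewrite gtr0_norm.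
  move=> /cvg_series_cvg_0 /cvgP /cvg_seq_bounded /ex_strict_bound_gt0[B B0 HB].
  by exists B => // k; apply/ltW/HB.
pose a := `|c 0%N|; have a0 : 0 < a by rewrite normr_gt0.
(* This [t] makes [2 * B * t < `|c 0| / 2] while keeping [t <= 1/2]. *)
pose t := a / (2 * (a + 2 * B)).
have D0 : 0 < a + 2 * B by rewrite addr_gt0 // mulr_gt0.
have t0 : 0 < t by rewrite divr_gt0 // mulr_gt0.
have t2 : t <= 2^-1.
  rewrite /t invfM mulrCA ler_piMr ?invr_ge0 // ler_pdivrMr // mul1r lerDl.
  by rewrite mulr_ge0 // ltW.
have Bt : t * (2 * B) < a / 2.
  have -> : t * (2 * B) = (a / 2) * (2 * B / (a + 2 * B)).
    by rewrite /t; field; rewrite gt_eqF.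
  by rewrite gtr_pMr ?divr_gt0 // ltr_pdivrMr // mul1r ltrDr.
clearbody t h0; have h0t : 0 < h0 * t by exact: mulr_gt0.
have h0t0 : h0 * t != 0 by rewrite gt_eqF.
have h0te : `|h0 * t| < e.
  rewrite gtr0_norm //; apply: lt_trans h0e.
  by rewrite gtr_pMr // (le_lt_trans t2) // invf_lt1 // ltr1n.
have := cvg_at _ h0t0 h0te; rewrite -cvg_shiftS.
move=> /cvgr0_norm_lt -/(_ (a / 2)); rewrite divr_gt0 // => /(_ isT)[N _ /(_ N)].
move=> /(_ (leqnn N)) /=.
rewrite /series /= big_nat_recl // expr0 mulr1 big_mkord.
set S := \sum_(i < N) _ => cS.
have SB : `|S| <= t * (2 * B).
  have -> : S = t * \sum_(i < N) (c i.+1 * h0 ^+ i.+1) * t ^+ i.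
    rewrite mulr_sumr; apply: eq_bigr => i _.
    by rewrite exprMn [t ^+ i.+1]exprS; ring.
  rewrite normrM gtr0_norm // ler_wpM2l ?(ltW t0) //.
  apply: le_trans (ler_norm_sum _ _ _) _.
  apply: (@le_trans _ _ (\sum_(i < N) t ^+ i * B)); last first.
    by rewrite -mulr_suml ler_wpM2r ?(ltW B0) // sum_expr_le2 // (ltW t0).
  apply: ler_sum => i _.
  rewrite normrM mulrC [`|t ^+ i|]ger0_norm ?exprn_ge0 ?(ltW t0) //.
  by rewrite ler_wpM2l ?exprn_ge0 ?(ltW t0).
have : a < a.
  rewrite {1}/a -{1}[c 0%N](addrK S) (le_lt_trans (ler_normB _ _)) //.
  by rewrite [X in _ < X]splitr ltrD // (le_lt_trans SB).
by rewrite ltxx.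
Qed.

Lemma power_series_eq0 c :
  (\forall h \near 0^', [series c k * h ^+ k]_k @ \oo --> (0 : C)) ->
  forall k, c k = 0.
Proof.
move=> c0 k; elim: k c c0 => [|k IH] c c0; first exact: power_series_eq0_coef0.
apply: (IH (fun k => c k.+1)).
have c00 := power_series_eq0_coef0 c0.
near=> h.
have hN0 : h != 0 by near: h; exact: nbhs_dnbhs_neq.
have -> : [series c k0.+1 * h ^+ k0]_k0 =
          (fun n => h^-1 * [series c k * h ^+ k]_k n.+1).
  apply/funext => n; rewrite /series /= big_nat_recl // c00 mul0r add0r.
  rewrite mulr_sumr; apply: eq_bigr => i _.
  by rewrite exprS; field.
rewrite -(mulr0 h^-1); apply: cvgMr.
rewrite (cvg_shiftS [series c k * h ^+ k]_k).
by near: h.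
Unshelve. all: by end_near.
Qed.

(** Two Laurent expansions may declare different pole orders; multiplied by one
    sufficiently high power of [w - a] both become power series with the same
    sum, to which the identity theorem applies. *)
Lemma is_residue_unique (f : C -> C) a r1 r2 :
  is_residue f a r1 -> is_residue f a r2 -> r1 = r2.
Proof.
move=> [u [m [<- um fu]]] [v [p [<- vp fv]]].
(* A common order bound, positive so that the coefficient of index -1 is among
   those of the power series. *)
pose M := (m + p).+1.
have toM (w : int -> C) (q : nat) h l : h != 0 -> (q <= M)%N ->
    (forall k : int, k < - q%:Z -> w k = 0) ->
    [series w (k%:Z - q%:Z) * h ^ (k%:Z - q%:Z)]_k @ \oo --> l ->
    [series w (k%:Z - M%:Z) * h ^+ k]_k @ \oo --> h ^+ M * l.
  move=> h0 qM w0 wl; rewrite -(cvg_shiftn (M - q)).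
  have -> : [sequence [series w (k%:Z - M%:Z) * h ^+ k]_k (n + (M - q))%N]_n =
    (fun n => h ^+ M * [series w (k%:Z - q%:Z) * h ^ (k%:Z - q%:Z)]_k n).
    apply/funext => n; rewrite /series /=.
    rewrite (@big_cat_nat _ _ _ (M - q)) ?leq_addl //= [X in X + _]big1_seq ?add0r.
      rewrite -{1}(add0n (M - q)%N) big_addn addnK mulr_sumr.
      apply: eq_bigr => i _.
      have -> : (i + (M - q))%:Z - M%:Z = i%:Z - q%:Z by lia.
      rewrite mulrCA; congr (_ * _).
      have -> : h ^+ M = h ^ M%:Z by [].
      rewrite -expfzDr //.
      have -> : M%:Z + (i%:Z - q%:Z) = (i + (M - q))%N by lia.
      by [].
    move=> i; rewrite andTb mem_index_iota => /andP[_ iM].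
    by rewrite w0 ?mul0r //; lia.
  exact: cvgMr.
suff /(_ M.-1) : forall k, u (k%:Z - M%:Z) - v (k%:Z - M%:Z) = 0.
  have -> : M.-1%:Z - M%:Z = -1 :> int by rewrite /M; lia.
  by move/eqP; rewrite subr_eq0 => /eqP.
apply: power_series_eq0.
have near0 (A : C -> C -> Prop) :
    (\forall w \near a^', A (w - a) w) -> \forall h \near 0^', A h (h + a).
  move=> /nbhs_ballP[e /= e0 He]; apply/nbhs_ballP; exists e => //= h.
  rewrite /ball /= sub0r normrN => he h0; rewrite -{1}[h](addrK a).
  apply: He; first by rewrite /ball /= opprD addrCA subrr addr0 normrN.
  by rewrite -subr_eq0 addrK.
have {}fu := near0 (fun x w =>
  [series u (k%:Z - m%:Z) * x ^ (k%:Z - m%:Z)]_k @ \oo --> f w) fu.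
have {}fv := near0 (fun x w =>
  [series v (k%:Z - p%:Z) * x ^ (k%:Z - p%:Z)]_k @ \oo --> f w) fv.
near=> h.
have h0 : h != 0 by near: h; exact: nbhs_dnbhs_neq.
rewrite -(subrr (h ^+ M * f (h + a))).
have -> : [series (u (k%:Z - M%:Z) - v (k%:Z - M%:Z)) * h ^+ k]_k =
  (fun n => [series u (k%:Z - M%:Z) * h ^+ k]_k n -
            [series v (k%:Z - M%:Z) * h ^+ k]_k n).
  apply/funext => n; rewrite /series /= -sumrB.
  by apply: eq_bigr => i _; rewrite mulrBl.
apply: cvgB.
  by apply: (toM u m) => //; [rewrite /M; lia | near: h].
by apply: (toM v p) => //; [rewrite /M; lia | near: h].
Unshelve. all: by end_near.
Qed.

Lemma near_neq a b : a != b -> \forall w \near a, w != b.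
Proof.
rewrite -subr_eq0 => ab; near=> w; rewrite -subr_eq0; near: w.
apply: (cvgr_neq0 (a - b)) => //.
by apply: cvgB; [exact: cvg_id | exact: cvg_cst].
Unshelve. all: by end_near.
Qed.

(** * Residues at simple poles *)

Definition has_power_series (f : C -> C) a := exists c : nat -> C,
  \forall w \near a, [series c k * (w - a) ^+ k]_k @ \oo --> f w.

Lemma has_power_series_cst a (b : C) : has_power_series (fun=> b) a.
Proof.
exists (fun k => if k is 0%N then b else 0); near=> w.
rewrite -cvg_shiftS.
have -> : [sequence [series (if k is 0 then b else 0) * (w - a) ^+ k]_k n.+1]_n
   = fun=> b; last exact: cvg_cst.
apply/funext => n; rewrite /series /= big_nat_recl // expr0 mulr1.
by rewrite big1 ?addr0 // => i _; rewrite mul0r.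
Unshelve. all: by end_near.
Qed.

Lemma has_power_seriesD (f g : C -> C) a :
  has_power_series f a -> has_power_series g a ->
  has_power_series (fun w => f w + g w) a.
Proof.
move=> [c cf] [d dg]; exists (fun k => c k + d k); near=> w.
have -> : [series (c k + d k) * (w - a) ^+ k]_k =
  (fun n => [series c k * (w - a) ^+ k]_k n + [series d k * (w - a) ^+ k]_k n).
  apply/funext => n; rewrite /series /= -big_split.
  by apply: eq_bigr => i _; rewrite mulrDl.
by apply: cvgD; near: w.
Unshelve. all: by end_near.
Qed.

Lemma has_power_seriesZ (f : C -> C) a b :
  has_power_series f a -> has_power_series (fun w => b * f w) a.
Proof.
move=> [c cf]; exists (fun k => b * c k); near=> w.
have -> : [series b * c k * (w - a) ^+ k]_k =
  (fun n => b * [series c k * (w - a) ^+ k]_k n).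
  apply/funext => n; rewrite /series /= mulr_sumr.
  by apply: eq_bigr => i _; rewrite mulrA.
by apply: cvgMr; near: w.
Unshelve. all: by end_near.
Qed.

Lemma has_power_series_sum (I : Type) (s : seq I) (P : pred I)
    (f : I -> C -> C) a :
  (forall i, P i -> has_power_series (f i) a) ->
  has_power_series (fun w => \sum_(i <- s | P i) f i w) a.
Proof.
move=> Hf; elim: s => [|i s IH].
  under eq_fun do rewrite big_nil.
  exact: has_power_series_cst.
under eq_fun do rewrite big_cons.
by have [Pi|//] := boolP (P i); apply: has_power_seriesD => //; exact: Hf.
Qed.

Lemma is_residue_simple_pole (f g : C -> C) a r : has_power_series g a ->
  (\forall w \near a^', f w = r / (w - a) + g w) -> is_residue f a r.
Proof.
move=> [c cg] fE.
exists (fun k => match k with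
  Posz k => c k | Negz k => if k is 0%N then r else 0 end).
exists 1%N; split=> [//|[k|[|k]] //|].
near=> w.
have w0 : w - a != 0 by rewrite subr_eq0; near: w; exact: nbhs_dnbhs_neq.
have -> : f w = r / (w - a) + g w by near: w.
rewrite -cvg_shiftS.
set S := (X in X @ \oo --> _).
have -> : S = (fun n => r / (w - a) + [series c k * (w - a) ^+ k]_k n).
  apply/funext => n; rewrite /S /series /= big_nat_recl //.
  rewrite exprN1; congr (_ + _); apply: eq_bigr => i _.
  by have -> : i.+1%:Z - 1 = i by lia.
apply: cvgD; first exact: cvg_cst.
near: w; exact: nbhs_dnbhs.
Unshelve. all: by end_near.
Qed.

End LaurentExpansions.

Section ComplexGeometricSeries.
Local Open Scope classical_set_scope.
Local Open Scope ring_scope.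
Variable R : realType.
Local Notation C := (R[i] : numFieldType).

(** The order of the complex numbers is partial, so the convergence of powers is
    reduced to that of real powers through the modulus. *)
Lemma cvg_expr_complex (q : C) :
  `|q| < 1 -> (fun n => q ^+ n) @ \oo --> (0 : C).
Proof.
move=> q1; apply/cvgr0Pnorm_lt => e e0.
have real_part (x : R[i]) : 0 <= x -> x = (complex.Re x)%:C.
  by move=> /ger0_Im xI; case: x xI => x y /= ->.
pose r := complex.Re `|q|.
have qr : `|q| = r%:C by exact: real_part.
have re : 0 < complex.Re e by rewrite -ltcR -real_part // ltW.
have r1 : `|r| < 1.
  have r0 : 0 <= r by rewrite -lecR -qr; exact: normr_ge0.
  by rewrite ger0_norm // -ltcR -qr.
have /cvgr0Pnorm_lt /(_ _ re) := cvg_expr r1.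
apply: filterS => n rn.
have qn : `|q ^+ n| = (r ^+ n)%:C by rewrite normrX rmorphXn; congr (_ ^+ _).
rewrite (real_part e (ltW e0)); apply: (le_lt_trans (y := (r ^+ n)%:C)).
  by rewrite -qn.
rewrite ltcR; exact: le_lt_trans (ler_norm _) rn.
Qed.

(** [1 / (w - b)] is [1 / (a - b)] times the sum of the geometric series of ratio
    [- (w - a) / (a - b)]. *)
Lemma has_power_series_inv (a b : C) : a != b ->
  has_power_series (fun w => (w - b)^-1) a.
Proof.
rewrite -subr_eq0 => ab; exists (fun k => (a - b)^-1 * (- (a - b)^-1) ^+ k).
have ab0 : 0 < `|a - b| by rewrite normr_gt0.
near=> w.
have wab : `|w - a| < `|a - b|.
  by near: w; apply: cvgr_distC_lt; [exact: cvg_id | ].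
pose q := - (w - a) / (a - b).
have q1 : `|q| < 1.
  by rewrite normrM normrN normfV ltr_pdivrMr // mul1r.
have wb : w - b != 0.
  apply: contraTneq wab => wb.
  by rewrite -(subrK b w) wb add0r distrC ltxx.
have qN1 : q != 1 by apply: contraTneq q1 => ->; rewrite normr1 ltxx.
have -> : [series (a - b)^-1 * (- (a - b)^-1) ^+ k * (w - a) ^+ k]_k =
          series (geometric (a - b)^-1 q).
  congr series; apply/funext => k.
  by rewrite /= -mulrA -exprMn /q; congr (_ * _ ^+ _); rewrite !mulNr mulrC.
rewrite geometric_seriesE //.
have -> : (w - b)^-1 = (a - b)^-1 * (1 - 0) / (1 - q).
  rewrite /q subr0 mulr1 -invfM; congr (_^-1); by field.
apply: cvgM; last exact: cvg_cst.
apply: cvgM; first exact: cvg_cst.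
by apply: cvgB; [exact: cvg_cst | exact: cvg_expr_complex].
Unshelve. all: by end_near.
Qed.

End ComplexGeometricSeries.

(** * Residues of the Pade approximant *)

(** [w * y_i / (w - z_i) = y_i + y_i z_i / (w - z_i)]: in the sum over [i] only
    the term [i = j] is singular at [z_j]. *)
Lemma residue_Z (R : realType) (s : nat -> R[i]) n (z y : 'I_n -> R[i]) :
    (forall l, (l < n.*2)%N -> f_shift s l.+2 0 != 0) ->
    Q_ s n = \prod_(j < n) ('X - (z j)%:P) -> injective z ->
    (forall k, (k < n)%N -> \sum_(j < n) y j * z j ^+ k = s k) ->
  forall j, residue (Z_ s n) (z j) = y j * z j.
Proof.
move=> F0 Qprod z_inj ys j.
have QzE w : (Q_ s n).[w] = \prod_(j < n) (w - z j).
  by rewrite Qprod horner_prod; apply: eq_bigr => i _; rewrite hornerXsubC.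
have Qz i : (Q_ s n).[z i] = 0 by rewrite QzE (bigD1 i) //= subrr mul0r.
suff Zj : is_residue (Z_ s n) (z j) (y j * z j).
  by apply: xget_unique => // r /is_residue_unique; apply.
apply: (is_residue_simple_pole (g := fun w =>
    \sum_(i < n) y i + \sum_(i < n | i != j) y i * z i * (w - z i)^-1)).
  apply: has_power_seriesD; first exact: has_power_series_cst.
  apply: has_power_series_sum => i ij.
  apply: has_power_seriesZ; apply: has_power_series_inv.
  by apply: contraNneq ij => /z_inj ->.
have near_z i : \forall w \near dnbhs (z j : (R[i] : numFieldType)), w != z i.
  have [->|ij] := eqVneq i j; first exact: nbhs_dnbhs_neq.
  apply: nbhs_dnbhs; apply: near_neq.
  by apply: contraNneq ij => /z_inj ->.
near=> w.
have wz : forall i, w != z i by near: w; exact: filter_forall.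
have wz0 i : w - z i != 0 by rewrite subr_eq0.
have Qw : (Q_ s n).[w] != 0 by rewrite QzE; apply/prodf_neq0.
rewrite /Z_ [s 0%N * w]mulrC -(mulrA w) (Pade_partial_fractions F0 ys) //.
rewrite mulr_sumr mulr_suml addrCA.
have <- : \sum_(i < n) y i * z i * (w - z i)^-1 = y j * z j / (w - z j) +
    \sum_(i < n | i != j) y i * z i * (w - z i)^-1 by rewrite (bigD1 j).
rewrite -big_split /=.
by apply: eq_bigr => i _; rewrite Qz subr0; field; rewrite wz0 Qw.
Unshelve. all: by end_near.
Qed.

Theorem proposition13 (R : realType) (n : nat) (hn : (1 <= n)%N)
    (s : 'cV[R[i]]_(2 * n))
    (hf : forall l : nat, (l <= 2 * n - 1)%N -> f_ (extend0 s) l 0 != 0)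
    (z : 'I_n -> R[i])
    (hz : Q_ (extend0 s) n = \prod_(j < n) ('X - (z j)%:P))
    (hsimple : forall j : 'I_n, mup (z j) (Q_ (extend0 s) n) = 1%N) :
  unique (fun x : 'cV[R[i]]_n => s = shifted_vandermonde (2 * n) z *m x)
         (\col_(j < n) residue (Z_ (extend0 s) n) (z j)).
Proof.
set e := extend0 s.
have F0 l : (l < n.*2)%N -> f_shift e l.+2 0 != 0.
  by move=> ln; rewrite -f_natE; apply: hf; rewrite -mul2n in ln; lia.
have z_inj : injective z by apply: simple_roots_inj => j; rewrite -hz.
have z0 j : z j != 0.
  apply: contraNneq (horner0_Q_neq0 F0) => zj0.
  by rewrite hz horner_prod (bigD1 j) //= zj0 hornerXsubC subrr mul0r.
have sE (k : 'I_(2 * n)) : s k 0 = e k.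
  by rewrite /e /extend0 valK.
have rowE (x : 'cV_n) (k : 'I_(2 * n)) :
    (shifted_vandermonde (2 * n) z *m x) k 0 =
    \sum_(j < n) x j 0 / z j * z j ^+ k.
  rewrite mxE; apply: eq_bigr => j _; rewrite mxE expfzDr // exprN1.
  by rewrite -[z j ^ k]/(z j ^+ k); field.
(* Every solution is the residue vector: this gives uniqueness, and reduces the
   rest of the statement to the existence of some solution. *)
have solE (x : 'cV_n) : s = shifted_vandermonde (2 * n) z *m x ->
    \col_(j < n) residue (Z_ e n) (z j) = x.
  move=> sx; apply/matrixP => j i; rewrite ord1 mxE.
  rewrite (residue_Z (y := fun j => x j 0 / z j) F0 hz z_inj) ?divfK // => k kn.
  have k2n : (k < 2 * n)%N by lia.
  by rewrite -(rowE x (Ordinal k2n)) -sx sE.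
split=> //.
have [y ys] := Vandermonde_moments e z_inj.
have sx : s = shifted_vandermonde (2 * n) z *m \col_j (y j * z j).
  apply/matrixP => k i; rewrite ord1 rowE sE.
  rewrite -(quadrature_extend F0 hz ys) -?mul2n //.
  by apply: eq_bigr => j _; rewrite mxE mulfK.
by rewrite (solE _ sx).
Qed.
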